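(* Let $G$ be a critical graph with $\chi(G) \geq \Delta(G) \geq 6$ such that $\mathcal{H}(G)$ is independent (i.e. has no edges). Then $G$ is the complete graph $K_{\chi(G)}$.
   Context: Graphs are finite and simple. $\chi(G)$ and $\Delta(G)$ denote the chromatic number and the maximum degree of $G$. A graph $G$ is critical if $\chi(G - v) < \chi(G)$ for every vertex $v$ of $G$. For a graph $G$, $\mathcal{H}(G)$ denotes the subgraph of $G$ induced on the vertices of degree at least $\chi(G)$ (possibly with no vertices). *)

(* Defs.v *)
From mathcomp Require Import all_boot.

Set Implicit Arguments.
Unset Strict Implicit.
Unset Printing Implicit Defensive.

Record sgraph := SGraph {
  svertex :> finType;
  adj : rel svertex;
  adj_sym : symmetric adj;
  adj_irrefl : irreflexive adj }.

Arguments adj {s}.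

Definition deg (G : sgraph) (v : G) : nat := #|[set w | adj v w]|.

Definition Delta (G : sgraph) : nat := \max_(v : G) deg v.

Definition colorable (G : sgraph) (k : nat) : bool :=
  [exists f : {ffun G -> 'I_k},
    [forall x, forall y, adj x y ==> (f x != f y)]].

Lemma colorable_ex (G : sgraph) : exists k, colorable G k.
Proof.
exists #|G|; apply/existsP; exists [ffun x => enum_rank x].
apply/forallP=> x; apply/forallP=> y; apply/implyP=> xy; rewrite !ffunE.
by apply: contraTneq xy => /enum_rank_inj ->; rewrite adj_irrefl.
Qed.

Definition chi (G : sgraph) : nat := ex_minn (colorable_ex G).

Section Induced.
Variables (G : sgraph) (A : {set G}).

Definition induced_adj : rel {x : G | x \in A} :=
  fun x y => adj (val x) (val y).

Lemma induced_adj_sym : symmetric induced_adj.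
Proof. by move=> x y; apply: adj_sym. Qed.

Lemma induced_adj_irrefl : irreflexive induced_adj.
Proof. by move=> x; apply: adj_irrefl. Qed.

Definition induced : sgraph := SGraph induced_adj_sym induced_adj_irrefl.
End Induced.

Definition delete_vertex (G : sgraph) (v : G) : sgraph := induced [set~ v].

Definition critical (G : sgraph) : Prop :=
  forall v : G, chi (delete_vertex v) < chi G.

Definition high_subgraph (G : sgraph) : sgraph :=
  induced [set v : G | chi G <= deg v].

Definition edgeless (G : sgraph) : Prop := forall x y : G, ~~ adj x y.

Section Complete.
Variable n : nat.

Definition complete_adj : rel 'I_n := fun x y => x != y.

Lemma complete_adj_sym : symmetric complete_adj.
Proof. by move=> x y; rewrite /complete_adj eq_sym. Qed.

Lemma complete_adj_irrefl : irreflexive complete_adj.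
Proof. by move=> x; rewrite /complete_adj eqxx. Qed.

Definition complete : sgraph := SGraph complete_adj_sym complete_adj_irrefl.
End Complete.

Definition isomorphic (G H : sgraph) : Prop :=
  exists2 f : G -> H, bijective f & forall x y, adj (f x) (f y) = adj x y.

(* Main.v *)
Require Import Defs.
From mathcomp Require Import all_boot.
From mathcomp Require Import fingroup perm zify.

Set Implicit Arguments.
Unset Strict Implicit.
Unset Printing Implicit Defensive.

(** Write k for the chromatic number; every degree is k - 1 (low) or k (high), and
    the high vertices are independent. Split k - 1 = r1 + r2 with r1, r2 >= 2 and take
    a partition (V1, V2) minimizing e(V1) + e(V2) - r1 |V1| - r2 |V2| and then the
    number of vertices to delete to make each Vi ri-colourable. The minimal
    non-ri-colourable subsets of Vi ("obstructions") are then ri-regular components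
    of Vi, and a low vertex of an obstruction can be moved to the other side, where
    it creates a new obstruction, without losing optimality.

    Keep moving low vertices in this way, never the one that has just arrived. By
    finiteness the walk returns to a component it has left, and the return is
    impossible unless at some moment two adjacent low vertices x, z of the current
    obstruction and a low vertex u of the one that x would create form a triangle.
    In that case all low neighbours of x have the same closed neighbourhood W as x.
    If W has at most one high vertex, it is a k-clique and hence all of G. Otherwise
    colour the complement of W with k - 1 colours; because k >= 6, two of the high
    vertices of W can receive the same colour, which leaves enough colours for the
    low vertices of W. *)

(** * Colourings of vertex subsets, minimal non-colourable sets and components *)

Section SetColoring.
Variable G : sgraph.
Implicit Types (x y v w p : G) (S T A B C D L : {set G}) (n : nat).

Definition nbrs v : {set G} := [set w | adj v w].

Definition colS n S : bool :=
  [exists f : {ffun G -> 'I_n},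
    [forall x in S, forall y in S, adj x y ==> (f x != f y)]].

Lemma colSP n S :
  reflect (exists f : G -> 'I_n, {in S &, forall x y, adj x y -> f x != f y})
          (colS n S).
Proof.
apply: (iffP existsP) => -[f Hf].
  exists f => x y xS yS xy.
  by move/forall_inP: Hf => /(_ x xS)/forall_inP/(_ y yS)/implyP; apply.
exists (finfun f); apply/forall_inP => x xS; apply/forall_inP => y yS.
by apply/implyP => xy; rewrite !ffunE; apply: Hf.
Qed.

Lemma colS_sub n S T : S \subset T -> colS n T -> colS n S.
Proof.
move=> /subsetP ST /colSP[f Hf]; apply/colSP; exists f => x y xS yS.
by apply: Hf; apply: ST.
Qed.

(** Swapping two colours on [B] makes the colourings agree at [x], the only possible common vertex;
    a disjoint pair is covered with any [x]. *)
Lemma colS_glue n A B x :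
    A :&: B \subset [set x] ->
    (forall a b, a \in A :\: B -> b \in B :\: A -> ~~ adj a b) ->
  colS n A -> colS n B -> colS n (A :|: B).
Proof.
move=> /subsetP ABx noAB /colSP[f Hf] /colSP[g Hg].
pose s := tperm (f x) (g x).
pose h v := if v \in A then f v else s (g v).
have hB v : v \in B -> h v = s (g v).
  rewrite /h; case: ifP => // vA vB.
  have /set1P -> : v \in [set x] by apply: ABx; rewrite inE vA.
  by rewrite /s tpermR.
have hA v : v \in A -> h v = f v by rewrite /h => ->.
apply/colSP; exists h => v w; rewrite !inE.
case vA: (v \in A); case wA: (w \in A) => //=.
- by move=> _ _ vw; rewrite !hA //; apply: Hf.
- case vB: (v \in B) => _ wB vw.
    by rewrite !hB // (inj_eq perm_inj); apply: Hg.
  have := noAB v w; rewrite !inE vA vB wA wB vw /=.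
  by move=> /(_ isT isT).
- case wB: (w \in B) => vB _ vw.
    by rewrite !hB // (inj_eq perm_inj); apply: Hg.
  have := noAB w v; rewrite !inE vA vB wA wB adj_sym vw /=.
  by move=> /(_ isT isT).
- by move=> vB wB vw; rewrite !hB // (inj_eq perm_inj); apply: Hg.
Qed.

Lemma colS_add n S v : colS n S -> #|nbrs v :&: S| < n -> colS n (v |: S).
Proof.
move=> /colSP[f Hf] small.
have [c cP] : exists c, c \notin f @: (nbrs v :&: S).
  apply/existsP; rewrite -negb_forall; apply/negP => /forallP all.
  have := leq_trans (leq_imset_card f (nbrs v :&: S)) (ltnW small).
  have -> : f @: (nbrs v :&: S) = setT by apply/setP => c; rewrite all inE.
  rewrite cardsT card_ord; have := leq_imset_card f (nbrs v :&: S).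
  have -> : f @: (nbrs v :&: S) = setT by apply/setP => c; rewrite all inE.
  rewrite cardsT card_ord; lia.
apply/colSP; exists (fun w => if w == v then c else f w) => x y.
have key w : w \in S -> adj v w -> c != f w.
  move=> wS vw; apply: contraNneq cP => ->.
  by apply: imset_f; rewrite !inE vw.
rewrite !inE; case: eqP => [->|_] /=; case: eqP => [->|_] //=.
- by rewrite adj_irrefl.
- by move=> _ yS; apply: key.
- by move=> xS _; rewrite adj_sym eq_sym; apply: key.
- exact: Hf.
Qed.

(** For positive [n] these are the sets inducing an (n+1)-vertex-critical subgraph. *)
Definition crit n D : bool :=
  ~~ colS n D && [forall T : {set G}, (T \proper D) ==> colS n T].

Lemma critP n D :
  reflect (~~ colS n D /\ forall T, T \proper D -> colS n T) (crit n D).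
Proof.
apply: (iffP andP) => -[nD H]; split=> //.
  by move=> T TD; move/forallP/(_ T)/implyP: H; apply.
by apply/forallP => T; apply/implyP; apply: H.
Qed.

Lemma crit_ex n S : ~~ colS n S -> exists2 D : {set G}, D \subset S & crit n D.
Proof.
move=> nS; have [D /minsetP[nD minD] DS] :=
  @minset_exists _ (fun T : {set G} => ~~ colS n T) S nS.
exists D => //; apply/critP; split=> // T /properP[TD [x xD xT]].
by apply: contraNT xT => nT; rewrite (minD T nT TD).
Qed.

Lemma crit_deg n D v : crit n D -> v \in D -> n <= #|nbrs v :&: D|.
Proof.
case/critP=> nD cD vD; rewrite leqNgt; apply: contra nD => small.
rewrite -(setD1K vD); apply: colS_add; first by apply: cD; apply: properD1.
by apply: leq_ltn_trans small; apply/subset_leq_card/setIS/subD1set.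
Qed.

(** Connectivity stated through cuts; the empty set qualifies. *)
Definition conn D := forall T, T \subset D -> T != set0 ->
  (forall a b, a \in T -> b \in D :\: T -> ~~ adj a b) -> T = D.

Lemma crit_conn n D : crit n D -> conn D.
Proof.
case/critP=> nD cD T TD /set0Pn[x xT] noT.
apply/eqP; apply: contraNT nD => nTD.
have TDp : T \proper D by rewrite properEneq nTD.
have -> : D = T :|: D :\: T.
  by apply/setP=> v; rewrite !inE; case: (boolP (v \in T)) => // /(subsetP TD) ->.
apply: (@colS_glue _ _ _ x); [|by move=> a b /setDP[aT _] /setDP[bT _]; apply: noT
  | exact: cD |].
  by apply/subsetP=> v; rewrite !inE => /andP[->].
apply: cD; rewrite properE subsetDl /=; apply/subsetPn; exists x.
  exact: (subsetP TD).
by rewrite inE xT.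
Qed.

(* A minimal non-colourable set has no cut vertex: colourings of the two lobes
   can be permuted to agree at the vertex. *)
Lemma crit_connD1 n D x : crit n D -> x \in D -> conn (D :\ x).
Proof.
case/critP=> nD cD xD T TD /set0Pn[y yT] noT.
apply/eqP; apply: contraNT nD => nTD.
have TDp : T \proper D :\ x by rewrite properEneq nTD.
have [yx yD] : y != x /\ y \in D.
  by have := subsetP TD y yT; rewrite !inE => /andP[].
have xT : x \notin T by apply: contraTN isT => /(subsetP TD); rewrite !inE eqxx.
have [z zD zT] : exists2 z, z \in D :\ x & z \notin T by case/properP: TDp.
have -> : D = (x |: T) :|: D :\: T.
  apply/setP=> v; rewrite !inE; case: eqP => [-> //|_] /=.
  by case: (boolP (v \in T)) => // /(subsetP TD); rewrite inE => /andP[].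
apply: (@colS_glue _ _ _ x).
- by apply/subsetP=> v; rewrite !inE; case: eqP => //= _ /andP[-> /andP[]].
- move=> a b; rewrite !inE negb_and negbK => /andP[aT' aT] /andP[bT /andP[bnT bD]].
  have {}aT : a \in T.
    by case/orP: aT aT' => [/eqP->|//]; rewrite (negbTE xT) xD.
  by apply: noT => //; move: bT; rewrite !inE negb_or => /andP[-> _]; rewrite bD bnT.
- apply: cD; rewrite properE; apply/andP; split.
    apply/subsetP=> v; rewrite !inE => /orP[/eqP->//|/(subsetP TD)].
    by rewrite inE => /andP[].
  apply/subsetPn; exists z; first by move: zD; rewrite inE => /andP[].
  by move: zD; rewrite !inE negb_or zT andbT => /andP[].
- apply: cD; rewrite properE subsetDl /=; apply/subsetPn; exists y => //.
  by rewrite inE yT.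
Qed.

(** Either a connected component of [S] or the empty set, which is why [comp_eq] asks for a common
    vertex. *)
Definition comp S C :=
  [/\ C \subset S, conn C &
      forall a b, a \in C -> b \in S -> adj a b -> b \in C].

Lemma comp_eq S B C v : comp S B -> comp S C -> v \in B -> v \in C -> B = C.
Proof.
have half A A' : comp S A -> comp S A' -> v \in A -> v \in A' -> A \subset A'.
  move=> [AS cA _] [A'S _ clA'] vA vA'.
  suff <- : A :&: A' = A by apply: subsetIr.
  apply: cA; first exact: subsetIl.
    by apply/set0Pn; exists v; rewrite inE vA.
  move=> a b /setIP[aA aA'] /setDP[bA]; rewrite inE bA /=.
  by apply: contra; apply: clA' => //; apply: (subsetP AS).
by move=> cB cC vB vC; apply/eqP; rewrite eqEsubset !half.
Qed.

Lemma compD1 S C x : comp S C -> x \notin C -> comp (S :\ x) C.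
Proof.
move=> [CS cC clC] xC; split=> //; first by rewrite subsetD1 CS.
by move=> a v aC /setD1P[_ vS]; apply: clC aC vS.
Qed.

Lemma card_nbrsD1 v D x : x \in D ->
  #|nbrs v :&: D| = adj v x + #|nbrs v :&: (D :\ x)|.
Proof. by move=> xD; rewrite (cardsD1 x) setIDA !inE xD andbT. Qed.

(** If [D :&: L] spanned no edge, then [L] and its complement would give a 2-colouring of [D]. The
    endpoint [x] can be chosen away from [p], the vertex that has just arrived in the walk. *)
Lemma crit_edge n D L p : 1 < n -> crit n D ->
    (forall x y, adj x y -> (x \in L) || (y \in L)) ->
  exists x y, [/\ x \in D :&: L, y \in D :&: L, adj x y & x != p].
Proof.
move=> n2 /critP[nD _] indep.
have [/exists_inP[x xDL /exists_inP[y yDL xy]]|noE] :=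
  boolP [exists x in D :&: L, exists y in D :&: L, adj x y].
  have [xp|xp] := eqVneq x p; last by exists x, y.
  exists y, x; split; rewrite 1?adj_sym //.
  by apply: contraTneq xy => ->; rewrite xp adj_irrefl.
case/negP: nD; case: n n2 => [|[|n]] // _; apply/colSP.
exists (fun v => if v \in L then ord0 else ord_max) => x y xD yD xy.
case xL: (x \in L); case yL: (y \in L) => //.
  case/negP: noE; apply/exists_inP; exists x; rewrite ?inE ?xD //.
  by apply/exists_inP; exists y; rewrite ?inE ?yD.
by have := indep x y xy; rewrite xL yL.
Qed.

Definition degset n : {set G} := [set v | #|nbrs v| == n].

(** For adjacent vertices this means equal closed neighbourhoods. *)
Definition twins x y := forall v, v != x -> v != y -> adj v x = adj v y.

Lemma adj_neq x y : adj x y -> x != y.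
Proof. by apply: contraTneq => ->; rewrite adj_irrefl. Qed.

End SetColoring.
Arguments degset : clear implicits.

(** * Two-sided partitions and their weight *)

Section Partition.
Variables (G : sgraph) (r : bool -> nat).
Implicit Types (x y z u v w : G) (P U S C K D E X : {set G}) (b : bool).

Definition side P b : {set G} := [set v | (v \in P) == b].
Definition flip x P : {set G} := [set v | (v \in P) (+) (v == x)].

Lemma flipK x P : flip x (flip x P) = P.
Proof. by apply/setP=> v; rewrite !inE addbK. Qed.

Lemma side_flip_src x P b : x \in side P b -> side (flip x P) b = side P b :\ x.
Proof.
rewrite inE => /eqP <-; apply/setP=> v; rewrite !inE.
by have [->|_] := eqVneq v x; [case: (x \in P) | rewrite addbF].
Qed.

Lemma side_flip_dst x P b :
  x \in side P b -> side (flip x P) (~~ b) = x |: side P (~~ b).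
Proof.
rewrite inE => /eqP <-; apply/setP=> v; rewrite !inE.
by have [->|_] := eqVneq v x; [case: (x \in P) | rewrite addbF].
Qed.

Lemma side_flip_dstD1 x P b :
  x \in side P b -> side (flip x P) (~~ b) :\ x = side P (~~ b).
Proof.
move=> xP; rewrite (side_flip_dst xP) setU1K //.
by move: xP; rewrite !inE => /eqP ->; case: b.
Qed.

Lemma mem_flip x P b : x \in side P b -> x \in side (flip x P) (~~ b).
Proof. by move=> xP; rewrite (side_flip_dst xP) !inE eqxx. Qed.

(* Twice the weight e(V1) + e(V2) + r2 |V1| + r1 |V2|, which differs by a constant
   from e(V1) + e(V2) - r1 |V1| - r2 |V2|. *)
Definition weight P :=
  \sum_v (#|nbrs v :&: side P (v \in P)| + 2 * r (v \notin P)).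

Lemma weight_flip x P b : x \in side P b ->
  weight (flip x P) + 2 * (#|nbrs x :&: side P b| + r (~~ b)) =
  weight P + 2 * (#|nbrs x :&: side P (~~ b)| + r b).
Proof.
move=> xP; have xb : (x \in P) = b by move: xP; rewrite inE => /eqP.
have sideN v c : v \in side P c -> (v \in P) = c by rewrite inE => /eqP.
have xNx : x \notin nbrs x by rewrite inE adj_irrefl.
rewrite /weight (bigD1 x) //= [in RHS](bigD1 x) //=.
have -> : (x \in flip x P) = ~~ b by rewrite inE eqxx xb addbT.
rewrite xb negbK (side_flip_dst xP).
have -> : nbrs x :&: (x |: side P (~~ b)) = nbrs x :&: side P (~~ b).
  apply/setP=> v; rewrite !inE; have [->|//] := eqVneq v x.
  by rewrite adj_irrefl.
set A := \sum_(v | v != x) _; set B := \sum_(v | v != x) _.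
(* The term of another vertex changes only if it is adjacent to [x]: it loses one on side [b] and
   gains one on the other side. *)
suff AB : A + #|nbrs x :&: side P b| = B + #|nbrs x :&: side P (~~ b)| by lia.
have cardE c : #|nbrs x :&: side P c| =
    \sum_(v | v != x) (adj x v && (v \in side P c)).
  rewrite -sum1_card big_mkcond /= (bigD1 x) //= inE (negbTE xNx) /= add0n.
  by apply: eq_bigr => v _; rewrite !inE; case: ifP.
rewrite !cardE /A /B -!big_split /=; apply: eq_bigr => v vx.
have -> : (v \in flip x P) = (v \in P) by rewrite inE (negbTE vx) addbF.
rewrite addnAC [RHS]addnAC; congr (_ + _).
rewrite (adj_sym x v) !inE.
have [vb|vb] := eqVneq (v \in P) b.
  rewrite vb (side_flip_src xP) (card_nbrsD1 v xP) andbT eq_sym.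
  by case: b {xP xb A B cardE vb} => /=; rewrite ?andbF; lia.
have vnb : (v \in P) = ~~ b by case: (v \in P) vb; case: (b).
have xM := mem_flip xP.
rewrite vnb (card_nbrsD1 v xM) (side_flip_dstD1 xP) eqxx andbT andbF; lia.
Qed.

Definition feasible P U := [forall b, colS (r b) (side P b :\: U)].

Variables (F0 t0 : nat).
Hypothesis weight_min : forall P, F0 <= weight P.
Hypothesis uncoloured_min :
  forall P U, weight P = F0 -> feasible P U -> t0 <= #|U|.

(** Lexicographic optimality: [F0] and [t0] are the successive minima, shown to be attained in
    [opt_ex]. *)
Definition opt P := weight P = F0 /\ exists2 U, feasible P U & #|U| = t0.

Hypothesis r_ge2 : forall b, 1 < r b.
Local Notation R := (r true + r false).
Local Notation low := (degset G R).

Let rR b : r b + r (~~ b) = R.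
Proof. by case: b; rewrite // addnC. Qed.

Hypothesis deg_le : forall v, #|nbrs v| <= R.+1.
Hypothesis high_indep : forall x y, adj x y -> (x \in low) || (y \in low).

Lemma card_nbrs_side P b v :
  #|nbrs v :&: side P b| + #|nbrs v :&: side P (~~ b)| = #|nbrs v|.
Proof.
rewrite -(cardsID (side P b) (nbrs v)); congr (_ + _); apply: eq_card => w.
by rewrite !inE; case: (w \in P); case: b; rewrite ?andbT ?andbF.
Qed.

(** With more neighbours on its own side, [v] would have at most [r (~~ b)] across, and moving it
    would lower the weight. *)
Lemma opt_deg P b v : opt P -> v \in side P b -> #|nbrs v :&: side P b| <= r b.
Proof.
move=> [wP _] vP; have := weight_flip vP; have := weight_min (flip v P).
by have := card_nbrs_side P b v; have := deg_le v; have := rR b; lia.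
Qed.

(** * Obstructions in optimal partitions and the effect of a move *)

Definition obst P b D := [/\ opt P, D \subset side P b & crit (r b) D].

Lemma obst_ex P b : opt P -> ~~ colS (r b) (side P b) -> exists D, obst P b D.
Proof. by move=> oP /crit_ex[D DP cD]; exists D. Qed.

Lemma opt_obst P : ~~ colS R [set: G] -> opt P -> exists b D, obst P b D.
Proof.
move=> nG oP.
have [colT|/(obst_ex oP)[D oD]] := boolP (colS (r true) (side P true)); last first.
  by exists true, D.
have [colF|/(obst_ex oP)[D oD]] := boolP (colS (r false) (side P false)); last first.
  by exists false, D.
case/negP: nG; have [/colSP[f Hf] /colSP[g Hg]] := (colT, colF); apply/colSP.
pose h v : 'I_(r true + r false) :=
  if v \in P then lshift (r false) (f v) else rshift (r true) (g v).
exists h => x y _ _ xy; rewrite /h.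
case xP: (x \in P); case yP: (y \in P).
- by rewrite (inj_eq (@lshift_inj _ _)); apply: Hf; rewrite // inE ?xP ?yP.
- by rewrite eq_lrshift.
- by rewrite eq_rlshift.
- by rewrite (inj_eq (@rshift_inj _ _)); apply: Hg; rewrite // inE ?xP ?yP.
Qed.

Lemma obst_reg P b D v : obst P b D -> v \in D -> #|nbrs v :&: D| = r b.
Proof.
move=> [oP DP cD] vD; apply/eqP; rewrite eqn_leq (crit_deg cD vD) andbT.
apply: leq_trans (opt_deg oP (subsetP DP v vD)).
by apply/subset_leq_card/setIS.
Qed.

(** Every vertex of [D] already has inside [D] the [r b] neighbours that optimality allows it on its
    side. *)
Lemma obst_comp P b D : obst P b D -> comp (side P b) D.
Proof.
move=> oD; have [oP DP cD] := oD; split=> //; first exact: crit_conn cD.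
move=> a v aD vP av.
suff /eqP E : nbrs a :&: D == nbrs a :&: side P b.
  by have : v \in nbrs a :&: D; [rewrite E !inE av; move: vP; rewrite inE | case/setIP].
by rewrite eqEcard setIS //= (obst_reg oD aD); apply/opt_deg/(subsetP DP).
Qed.

Lemma obst_compD1 P b D x : obst P b D -> x \in D -> comp (side P b :\ x) (D :\ x).
Proof.
move=> oD xD; have [oP DP cD] := oD; split; first exact: setSD.
  exact: crit_connD1 cD xD.
have [_ _ cl] := obst_comp oD.
move=> a v /setD1P[_ aD] /setD1P[vx vP] av; rewrite !inE vx /=.
exact: cl av.
Qed.

(** A low [x] has [r b] neighbours on its side and [r (~~ b)] across, so the weight is kept. The
    move makes [D :\ x] colourable and saves a deleted vertex on side [b]; minimality of [t0] then
    forces a new obstruction through [x] across. *)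
Lemma obst_move P b D x : obst P b D -> x \in D -> x \in low ->
  exists2 E, obst (flip x P) (~~ b) E & x \in E.
Proof.
move=> oD xD xlow; have [oP DP cD] := oD; have [nD smallD] := critP _ _ cD.
have [_ _ clD] := obst_comp oD.
have [wP [U fU cU]] := oP; have xP := subsetP DP x xD.
have wP' : weight (flip x P) = F0.
  have := weight_flip xP; have := card_nbrs_side P b x.
  have regx : #|nbrs x :&: side P b| = r b.
    apply/eqP; rewrite eqn_leq opt_deg //= -(obst_reg oD xD).
    exact/subset_leq_card/setIS.
  by move: xlow; rewrite inE => /eqP; have := rR b; lia.
have fUb c : colS (r c) (side P c :\: U) by move/forallP: fU.
pose U1 := U :\: D.
(* [U] must meet [D], since [D] is not colourable. *)
have U1lt : #|U1| < #|U|.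
  apply: proper_card; rewrite properE subsetDl /=.
  apply: contra nD => UD; apply: colS_sub (fUb b).
  apply/subsetP=> v vD; rewrite inE (subsetP DP) // andbT.
  by apply: contraL vD => /(subsetP UD); rewrite inE => /andP[].
have colb : colS (r b) (side P b :\ x :\: U1).
  apply: (@colS_sub _ _ _ ((D :\ x) :|: (side P b :\: U :\: D))).
    apply/subsetP=> v /setDP[/setD1P[vx vP] vU1].
    rewrite in_setU in_setD1 vx in_setD in_setD vP andbT /=.
    by move: vU1; rewrite in_setD; case: (v \in D).
  apply: (@colS_glue _ _ _ _ x).
  - by apply/subsetP=> v; rewrite !inE; case: (v \in D); rewrite ?andbF ?andbT.
  - move=> a v /setDP[/setD1P[_ aD] _] /setDP[/setDP[/setDP[vP _] vD] _].
    by apply: contra vD; apply: clD.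
  - by apply: smallD; apply: properD1.
  - by apply: colS_sub (fUb b); apply: subsetDl.
have sideN : side P (~~ b) :\: U1 = side P (~~ b) :\: U.
  apply/setP=> v; rewrite in_setD [RHS]in_setD in_setD negb_and negbK.
  case: (boolP (v \in D)) => //= /(subsetP DP); rewrite !inE => /eqP->.
  by case: (b); rewrite /= ?andbF.
have xU1 : x \notin U1 by rewrite inE xD.
have tP' V : feasible (flip x P) V -> #|V| < t0 -> False.
  by move=> fV; rewrite ltnNge (uncoloured_min wP' fV).
have ncol : ~~ colS (r (~~ b)) (x |: (side P (~~ b) :\: U)).
  apply/negP => col; apply: (tP' U1); last by rewrite -cU.
  apply/forallP=> c; have [->|cb] := eqVneq c b.
    by rewrite (side_flip_src xP).
  have -> : c = ~~ b by case: (c) (b) cb => [] [].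
  rewrite (side_flip_dst xP); apply: colS_sub col.
  by rewrite setDUl sideN setSU ?subsetDl.
have [E Esub cE] := crit_ex ncol; exists E.
  split=> //.
    (* Deleting [x] in place of the saved vertices costs at most [t0], so the new partition is again
       optimal. *)
    have fxU1 : feasible (flip x P) (x |: U1).
      apply/forallP=> c; have [->|cb] := eqVneq c b.
        rewrite (side_flip_src xP); apply: colS_sub colb.
        by apply/setDS/subsetUr.
      have -> : c = ~~ b by case: (c) (b) cb => [] [].
      rewrite (side_flip_dst xP); apply: colS_sub (fUb (~~ b)).
      rewrite -sideN; apply/subsetP=> v; rewrite !inE.
      by case: eqP => //= _; case: (v \in U).
    split=> //; exists (x |: U1) => //.
    apply/eqP; rewrite eqn_leq (uncoloured_min wP' fxU1) cardsU1 xU1 -cU.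
    by rewrite U1lt.
  apply: subset_trans Esub _; rewrite (side_flip_dst xP).
  by apply/setUS/subsetDl.
have [nE _] := critP _ _ cE; apply: contraNT nE => xE.
apply: colS_sub (fUb (~~ b)); apply/subsetP=> v vE.
have := subsetP Esub v vE; rewrite in_setU1 => /orP[/eqP vx|//].
by rewrite -vx vE in xE.
Qed.

Lemma obst_sub P b D v : obst P b D -> v \in D -> v \in side P b.
Proof. by case=> _ DP _; apply: (subsetP DP). Qed.

Lemma moved_comp P b E x : x \in side P b -> obst (flip x P) (~~ b) E ->
  x \in E -> comp (side P (~~ b)) (E :\ x).
Proof. by move=> xP oE xE; rewrite -(side_flip_dstD1 xP); apply: obst_compD1. Qed.

Lemma moved_closed P b E x v : x \in side P b -> obst (flip x P) (~~ b) E ->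
  x \in E -> v \in side P (~~ b) -> adj x v -> v \in E.
Proof.
move=> xP oE xE vP xv; have [_ _ cl] := obst_comp oE; apply: cl xE _ xv.
by rewrite (side_flip_dst xP) in_setU1 vP orbT.
Qed.

(* The neighbours of a vertex x of an obstruction D are exactly the vertices that
   D - x misses to be regular, so they are determined by the set D - x. *)
Lemma same_nbrs P Q b D E x y v : obst P b D -> obst Q b E -> x \in D ->
  y \in E -> D :\ x = E :\ y -> v \in D :\ x -> adj v x = adj v y.
Proof.
move=> oD oE xD yE DE vDx; have vEy : v \in E :\ y by rewrite -DE.
have := obst_reg oD (subsetP (subD1set _ _) _ vDx).
rewrite -(obst_reg oE (subsetP (subD1set _ _) _ vEy)).
by rewrite (card_nbrsD1 v xD) (card_nbrsD1 v yE) DE => /addIn; do 2 case: adj.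
Qed.

(** Both sets are components of the far side of the unmoved [P], and they share [w]. *)
Lemma moved_eq P b D x z E E' w : obst P b D -> x \in D -> z \in D ->
    obst (flip x P) (~~ b) E -> x \in E -> obst (flip z P) (~~ b) E' -> z \in E' ->
    w \in side P (~~ b) -> w \in E -> w \in E' ->
  E :\ x = E' :\ z.
Proof.
move=> oD xD zD oE xE oE' zE' wP wE wE'.
have nside v : v \in D -> w != v.
  by move=> /(obst_sub oD); apply: contraTneq => <-; move: wP; rewrite !inE;
     move=> /eqP ->; case: (b).
by apply: (comp_eq (v := w) (moved_comp (obst_sub oD xD) oE xE)
                (moved_comp (obst_sub oD zD) oE' zE')); rewrite in_setD1 nside.
Qed.

(* Moving u back after x must rebuild an obstruction on D - x, since z links u to it. *)
Lemma twin_across P b D x E u z v : obst P b D -> x \in D ->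
    obst (flip x P) (~~ b) E -> x \in E -> u \in E -> u \in low -> u != x ->
    z \in D -> z != x -> adj z u -> v \in D :\ x ->
  adj v u = adj v x.
Proof.
move=> oD xD oE xE uE ulow ux zD zx zu vD; have xP := obst_sub oD xD.
have [E2] := obst_move oE uE ulow; rewrite negbK => oE2 uE2.
have uP : u \in side (flip x P) (~~ b) := obst_sub oE uE.
have sideE : side (flip x P) b = side P b :\ x by rewrite (side_flip_src xP).
have c2 : comp (side P b :\ x) (E2 :\ u).
  rewrite -sideE; have := @moved_comp (flip x P) (~~ b) E2 u uP.
  by rewrite negbK; apply.
have zE2 : z \in E2.
  have := @moved_closed (flip x P) (~~ b) E2 u z uP; rewrite negbK; apply=> //.
    by rewrite sideE in_setD1 zx (obst_sub oD zD).
  by rewrite adj_sym.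
have zu' : z != u by apply: contraTneq zu => ->; rewrite adj_irrefl.
have DE : D :\ x = E2 :\ u.
  by apply: (comp_eq (v := z) (obst_compD1 oD xD) c2); rewrite in_setD1 ?zx ?zu'.
by rewrite (same_nbrs oD oE2 xD uE2 DE vD).
Qed.

(** * Triangles of low vertices and twins *)

(* E is the obstruction created by moving x out of D. *)
Record triangle P b D x E z u : Prop := Triangle {
  tri_obst : obst P b D;
  tri_moved : obst (flip x P) (~~ b) E;
  tri_mem : [/\ x \in D, z \in D, x \in E & u \in E];
  tri_low : [/\ x \in low, z \in low & u \in low];
  tri_adj : [/\ adj x z, adj x u & adj z u] }.

(** For [v] in [D], compare [x] and [z] with [u] through [twin_across]. Across, moving [x] or [z]
    completes the same component, so [same_nbrs] applies. Elsewhere neither is adjacent to [v]. *)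
Lemma triangle_twins P b D x E z u : triangle P b D x E z u -> twins x z.
Proof.
case=> oD oE [xD zD xE uE] [xlow zlow ulow] [xz xu zu].
have [E' oE' zE'] := obst_move oD zD zlow.
have [xP zP] := (obst_sub oD xD, obst_sub oD zD).
have ux : u != x by rewrite eq_sym adj_neq.
have uP : u \in side P (~~ b).
  by have := obst_sub oE uE; rewrite (side_flip_dst xP) in_setU1 (negbTE ux).
have uE' : u \in E' := moved_closed zP oE' zE' uP zu.
have EE := moved_eq oD xD zD oE xE oE' zE' uP uE uE'.
have [_ _ clD] := obst_comp oD.
move=> v vx vz; have [vP|vP] := boolP (v \in side P b).
  have [vD|vD] := boolP (v \in D).
    rewrite -(@twin_across P b D x E u z v) // ?in_setD1 ?vx ?vD //; last first.
      by rewrite eq_sym adj_neq.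
    rewrite -(@twin_across P b D z E' u x v) // ?in_setD1 ?vz ?vD //.
    - by rewrite eq_sym adj_neq.
    - exact: adj_neq.
  rewrite !(adj_sym v).
  have -> : adj x v = false by apply: contraNF vD; apply: clD.
  by apply/esym; apply: contraNF vD; apply: clD.
have {}vP : v \in side P (~~ b) by move: vP; rewrite !inE; case: (v \in P); case: (b).
have [vE|vE] := boolP (v \in E).
  by apply: (same_nbrs oE oE' xE zE' EE); rewrite in_setD1 vx.
rewrite !(adj_sym v).
have -> : adj x v = false by apply: contraNF vE; apply: (moved_closed xP oE xE).
apply/esym; apply: contraNF vE => zv.
have : v \in E' :\ z by rewrite in_setD1 vz (moved_closed zP oE').
by rewrite -EE => /setD1P[].
Qed.

Lemma triangle_swap P b D x E z u :
  triangle P b D x E z u -> triangle (flip x P) (~~ b) E x D u z.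
Proof.
case=> oD oE [xD zD xE uE] [xlow zlow ulow] [xz xu zu].
by split; rewrite ?flipK ?negbK //; split=> //; rewrite adj_sym.
Qed.

(** If [y] lies in [D], it can replace [z] in the triangle; if it lies across, it is in [E], and
    moving [x] first exchanges the roles of [D] and [E]. *)
Lemma triangle_all_twins P b D x E z u y :
  triangle P b D x E z u -> y \in low -> adj x y -> twins x y.
Proof.
have half P' b' D' E' z' u' : triangle P' b' D' x E' z' u' ->
    y \in low -> adj x y -> y \in D' -> twins x y.
  move=> [oD oE [xD zD xE uE] [xlow zlow ulow] [xz xu zu]] ylow xy yD.
  apply: (@triangle_twins P' b' D' x E' y u'); split=> //; split=> //.
  rewrite (twin_across oD xD oE xE uE ulow _ zD _ zu) ?in_setD1 ?yD.
  - by rewrite adj_sym.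
  - by rewrite eq_sym adj_neq.
  - by rewrite eq_sym adj_neq.
  - by rewrite eq_sym adj_neq.
move=> tri ylow xy; have [oD oE [xD _ xE _] _ _] := tri.
have [yP|yP] := boolP (y \in side P b).
  by apply: half tri _ _ _ => //; have [_ _ cl] := obst_comp oD; apply: cl xD yP xy.
apply: half (triangle_swap tri) _ _ _ => //.
apply: (moved_closed (obst_sub oD xD) oE xE) xy.
by move: yP; rewrite !inE; case: (y \in P); case: (b).
Qed.

(** * The walk of moved low vertices *)

(* x is the vertex about to leave and X the visited set together with the current
   obstruction: if C is ever re-entered, then z, having a neighbour in K, would have
   to complete K to an obstruction, but the degree of w in K + z is wrong. *)
Definition blocked P c x X C := exists z K q w,
  [/\ z \in C, z \in low, K \subset X & comp (side P (~~ c) :\ x) K] /\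
  [/\ q \in K, adj z q, w \in K & adj w z + #|nbrs w :&: K| != r (~~ c)].

(** Invariant of the walk: [X] is a union of blocked components of the current sides, with the
    blocking sets [K] inside [Y]. *)
Definition visited P x Y X := forall v, v \in X -> exists C c,
  [/\ v \in C, C \subset X, comp (side P c) C & blocked P c x Y C].

Lemma blocked_no_return P b x E C : x \in side P b ->
    obst (flip x P) (~~ b) E -> x \in E -> C = E :\ x ->
  forall Y, ~ blocked P (~~ b) x Y C.
Proof.
move=> xP oE xE CE Y [z [K [q [w]]]]; rewrite negbK => -[[zC zlow _ cK] [qK zq wK]].
move: zC; rewrite CE => /setD1P[zx zE].
have [E2] := obst_move oE zE zlow; rewrite negbK => oE2 zE2.
have zP := obst_sub oE zE.
have cE2 : comp (side P b :\ x) (E2 :\ z).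
  by rewrite -side_flip_src //; have := moved_comp zP; rewrite negbK; apply.
have qE2 : q \in E2 :\ z.
  rewrite in_setD1 eq_sym adj_neq //=.
  have := @moved_closed (flip x P) (~~ b) E2 z q zP; rewrite negbK; apply=> //.
  by rewrite side_flip_src //; have [KS _ _] := cK; apply: (subsetP KS).
rewrite (comp_eq cK cE2 qK qE2) in wK *.
by rewrite -card_nbrsD1 // (obst_reg oE2) ?eqxx //; case/setD1P: wK.
Qed.

Hypothesis no_triangle : forall P b D x E z u, ~ triangle P b D x E z u.

(** Supplies the wrong degree in [blocked]. If [z] and [x'] agreed on [E :\ x'], then [x] would be
    adjacent to [x']. Either [x, z, x'] form a triangle, or a further common neighbour [w] of [z]
    and [x'] gives, by [moved_eq], that [x'] sees [z] as it sees [x]. *)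
Lemma not_refill P b D x E z x' : obst P b D -> x \in D -> z \in D ->
    x \in low -> z \in low -> adj x z -> obst (flip x P) (~~ b) E -> x \in E ->
    x' \in E -> x' \in low -> x' != x ->
  exists2 w, w \in E :\ x' & adj w z != adj w x'.
Proof.
move=> oD xD zD xlow zlow xz oE xE x'E x'low x'x.
apply/exists_inP; apply: contraT; rewrite negb_exists_in => /forall_inP same.
have {}same w : w \in E :\ x' -> adj w z = adj w x'.
  by move=> /same; rewrite negbK => /eqP.
have xx' : adj x x' by rewrite -same // in_setD1 xE eq_sym x'x.
have [zx'|zx'] := boolP (adj z x'); first by case: (@no_triangle P b D x E z x').
have [w /setIP[wN /setD1P[wx wE]]] : exists w, w \in nbrs x' :&: (E :\ x).
  apply/set0Pn; rewrite -card_gt0.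
  have := card_nbrsD1 x' xE; rewrite (obst_reg oE x'E).
  move=> regx'; have := r_ge2 (~~ b); rewrite regx'.
  by case: adj; rewrite ?add1n ?add0n // => /ltnW.
have x'w : adj x' w by move: wN; rewrite inE.
have wz : adj z w.
  by rewrite adj_sym same ?in_setD1 ?wE ?andbT 1?adj_sym // eq_sym adj_neq.
have [E' oE' zE'] := obst_move oD zD zlow.
have [xP zP] := (obst_sub oD xD, obst_sub oD zD).
have wP : w \in side P (~~ b).
  by have := obst_sub oE wE; rewrite (side_flip_dst xP) in_setU1 (negbTE wx).
have wE' : w \in E' := moved_closed zP oE' zE' wP wz.
have EE := moved_eq oD xD zD oE xE oE' zE' wP wE wE'.
have := same_nbrs oE oE' xE zE' EE (_ : x' \in E :\ x).
by rewrite in_setD1 x'x x'E => /(_ isT); rewrite !(adj_sym x') xx' (negbTE zx').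
Qed.

(* One step moves x across and adds D - x to the visited set X, so X grows at each
   step as long as the walk does not come back to it. *)
Lemma no_walk m P b D x z X : #|~: X| < m -> obst P b D -> x \in D -> z \in D ->
    x \in low -> z \in low -> adj x z -> [disjoint X & D] ->
  visited P x (X :|: D) X -> False.
Proof.
elim: m P b D x z X => // m IHm P b D x z X Xm oD xD zD xlow zlow xz XD vX.
have [E oE xE] := obst_move oD xD xlow.
have xP := obst_sub oD xD.
have notD v : v \in X -> v \notin D by move=> vX'; rewrite (disjointFr XD).
have xX : x \notin X by apply: contraL xD => /notD.
have sideNb v : v \in E -> v != x -> v \in side P (~~ b).
  by move=> vE vx; rewrite -(side_flip_dstD1 xP) in_setD1 vx (obst_sub oE).
(* A visited component meeting [E] would equal [E :\ x], a return that [blocked] excludes. *)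
have noHit v : v \in X -> v \notin E.
  move=> vX'; apply/negP => vE; have [C [c [vC CX cC bC]]] := vX v vX'.
  have vx : v != x by apply: contraNneq xX => <-.
  have cb : c = ~~ b.
    have [CS _ _] := cC; have := subsetP CS v vC; have := sideNb v vE vx.
    by rewrite !inE => /eqP -> /eqP.
  rewrite cb in cC bC; apply: (blocked_no_return xP oE xE _ bC).
  by apply: (comp_eq (v := v) cC (moved_comp xP oE xE)); rewrite // in_setD1 vx.
have [oP' EP' cE] := oE.
have [x' [z' [/setIP[x'E x'low] /setIP[z'E z'low] x'z' x'x]]] :=
  crit_edge x (r_ge2 (~~ b)) cE high_indep.
have [w wE' wne] := not_refill oD xD zD xlow zlow xz oE xE x'E x'low x'x.
have zx : z != x by rewrite eq_sym adj_neq.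
pose X' := X :|: D :\ x.
(* Visited components survive the move: [x] lies in none of them, and one across adjacent to [x]
   would meet [E]. *)
have side_ext c C : C \subset X -> comp (side P c) C -> comp (side (flip x P) c) C.
  move=> CX cC0; have [CS cC clC] := cC0.
  have xC : x \notin C by apply: contra xX; apply: (subsetP CX).
  have [cb|cb] := eqVneq c b.
    by rewrite cb (side_flip_src xP) -cb; apply: compD1.
  have {}cb : c = ~~ b by case: (c) (b) cb => [] [].
  rewrite cb (side_flip_dst xP) in CS clC *; split=> //.
    exact: subset_trans CS (subsetUr _ _).
  move=> a v aC; rewrite in_setU1 => /orP[/eqP->|vP av]; last exact: clC av.
  rewrite adj_sym => xa; have := noHit a (subsetP CX a aC).
  by rewrite (moved_closed xP oE xE (subsetP CS a aC) xa).
have x'D : x' \notin D.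
  by apply/negP => /(obst_sub oD); have := sideNb x' x'E x'x; rewrite !inE;
     move=> /eqP ->; case: (b).
have x'X : x' \notin X by apply/negP => /noHit; rewrite x'E.
have XX' : X :|: D \subset x |: X'.
  apply/subsetP=> v; rewrite !inE; case: (v \in X) => /=; rewrite ?orbT //.
  by case: eqP.
have K_ext c K : K \subset X :|: D -> comp (side P c :\ x) K ->
    comp (side (flip x P) c :\ x') K.
  move=> KX cK; apply: compD1; last first.
    by apply: contra x'D => /(subsetP KX); rewrite inE (negbTE x'X).
  have [cb|cb] := eqVneq c b; first by rewrite cb (side_flip_src xP) -cb.
  have {}cb : c = ~~ b by case: (c) (b) cb => [] [].
  have sN : side P c :\ x = side P c.
    apply/setP=> v; rewrite in_setD1; have [->|//] := eqVneq v x.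
    by move: xP; rewrite cb !inE => /eqP ->; case: (b).
  rewrite sN in cK; apply: side_ext => //; apply/subsetP=> v vK.
  have := subsetP KX v vK; rewrite in_setU => /orP[//|/(obst_sub oD)].
  have [KS _ _] := cK; have := subsetP KS v vK.
  by rewrite cb !inE => /eqP ->; case: (b).
apply: (IHm (flip x P) (~~ b) E x' z' X') => //.
- rewrite ltnS in Xm; apply: leq_trans Xm; apply: proper_card.
  rewrite properE setCS subsetUl setCS; apply/subsetPn; exists z.
    by rewrite !inE zx zD orbT.
  by apply/negP => /notD; rewrite zD.
- rewrite disjoint_subset; apply/subsetP=> v; rewrite in_setU in_setD1.
  case/orP=> [/noHit//|/andP[vx vD]]; rewrite inE; apply: contraL vD => vE.
  by apply/negP => /(obst_sub oD); have := sideNb v vE vx; rewrite !inE;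
     move=> /eqP ->; case: (b).
have sub' : X :|: D \subset X' :|: E.
  apply: subset_trans XX' _; apply/subsetP=> v; rewrite in_setU1 in_setU.
  by case/orP=> [/eqP->|->//]; rewrite xE orbT.
move=> v; rewrite in_setU => /orP[vX'|vD].
  have [C [c [vC CX cC [z0 [K [q [w0 [[z0C z0low KX cK] Kq]]]]]]]] := vX v vX'.
  exists C, c; split=> //.
  - exact: subset_trans CX (subsetUl _ _).
  - exact: side_ext.
  exists z0, K, q, w0; split=> //; split=> //; first exact: subset_trans KX sub'.
  exact: K_ext.
exists (D :\ x), b; split=> //; first exact: subsetUr.
  by rewrite (side_flip_src xP); apply: obst_compD1.
(* The component [D :\ x] being left is blocked by [z]: its neighbour [x] lies in [E :\ x'], and
   there [w] has the right degree with [x'], hence the wrong one with [z]. *)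
exists z, (E :\ x'), x, w; split; split=> //.
- by rewrite in_setD1 zx.
- by apply: subset_trans (subD1set _ _) _; apply: subsetUr.
- exact: obst_compD1.
- by rewrite in_setD1 eq_sym x'x.
- by rewrite adj_sym.
have := obst_reg oE (subsetP (subD1set _ _) _ wE').
rewrite (card_nbrsD1 w x'E) => <-; rewrite eqn_add2r.
by move: wne; do 2 case: adj.
Qed.

End Partition.

(** * Existence of an optimal partition and of a low triangle *)

Lemma opt_ex (G : sgraph) (r : bool -> nat) : (forall b, 0 < r b) ->
  exists F0 t0 (P : {set G}),
  [/\ forall P', F0 <= @weight G r P',
      forall (P' U : {set G}), weight r P' = F0 -> feasible r P' U -> t0 <= #|U| &
      opt r F0 t0 P].
Proof.
move=> r_gt0.
have [P0 _ minP0] := arg_minnP (P := predT) (i0 := set0 : {set G}) (weight r) isT.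
pose good (PU : {set G} * {set G}) := (weight r PU.1 == weight r P0) && feasible r PU.1 PU.2.
have good0 : good (P0, setT).
  rewrite /good eqxx; apply/forallP=> b; rewrite setDT; apply/colSP.
  by exists (fun=> Ordinal (r_gt0 b)) => x y; rewrite inE.
have [[P U] /andP[/eqP wP fU] minU] := arg_minnP (fun PU : {set G} * {set G} => #|PU.2|) good0.
exists (weight r P0), #|U|, P; split.
- by move=> P'; apply: minP0.
- by move=> P' U' wP' fU'; apply: (minU (P', U')); rewrite /good wP' eqxx.
by split=> //; exists U.
Qed.

(** A boolean [Q] allows arguing by contradiction: if [Q] fails, no triangle occurs, and the walk
    started with nothing visited is impossible. *)
Lemma low_clique_twins (G : sgraph) (R : nat) (Q : bool) : 3 < R ->
    (forall v : G, #|nbrs v| <= R.+1) ->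
    (forall x y : G, adj x y -> (x \in degset G R) || (y \in degset G R)) ->
    ~~ colS R [set: G] ->
    (forall x z u : G, [/\ x \in degset G R, z \in degset G R & u \in degset G R] ->
       [/\ adj x z, adj x u & adj z u] ->
       (forall y, y \in degset G R -> adj x y -> twins x y) -> Q) ->
  Q.
Proof.
move=> R4 deg_le indep nG triQ; apply: contraT => /negP nQ.
pose r b := if b then 2 else R - 2.
have rE : R = r true + r false by rewrite /r; lia.
have r_ge2 b : 1 < r b by rewrite /r; case: b; lia.
have [F0 [t0 [P [minW minU oP]]]] := @opt_ex G r (fun b => ltnW (r_ge2 b)).
rewrite rE in deg_le indep nG triQ.
have [b [D oD]] := opt_obst nG oP; have [_ _ cD] := oD.
have noTri (P' : {set G}) b' D' x E z u : ~ triangle r F0 t0 P' b' D' x E z u.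
  move=> tri; apply: nQ; have [_ _ _ lowT adjT] := tri.
  by apply: (triQ _ _ _ lowT adjT) => y; apply: triangle_all_twins tri.
have [p _] : exists p, p \in D.
  apply/set0Pn; have [nD _] := critP _ _ cD; apply: contraNneq nD => ->.
  by apply/colSP; exists (fun=> Ordinal (ltnW (r_ge2 b))) => x y; rewrite inE.
have [x [z [/setIP[xD xlow] /setIP[zD zlow] xz _]]] :=
  crit_edge p (r_ge2 b) cD indep.
case: (@no_walk G r F0 t0 minW minU r_ge2 deg_le indep noTri _ P b D x z set0
         (ltnSn _) oD xD zD xlow zlow xz).
  by rewrite disjoint_subset; apply/subsetP=> v; rewrite inE.
by move=> v; rewrite inE.
Qed.

Lemma card_inj_le (T1 T2 : finType) (A : {set T1}) (B : {set T2}) : #|A| <= #|B| ->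
  0 < #|A| -> exists f : T1 -> T2, {in A, forall v, f v \in B} /\ {in A &, injective f}.
Proof.
move=> AB A0; have /card_gt0P[c _] := leq_trans A0 AB.
exists (fun v => nth c (enum B) (index v (enum A))).
have sz v : v \in A -> index v (enum A) < size (enum B).
  by move=> vA; rewrite -cardE; apply: leq_trans AB; rewrite cardE index_mem mem_enum.
split=> [v vA|v w vA wA /eqP].
  by rewrite -(mem_enum B); apply: mem_nth; apply: sz.
rewrite nth_uniq ?enum_uniq ?sz // => /eqP /(congr1 (nth v (enum A))).
by rewrite !nth_index ?mem_enum.
Qed.

(** * Recolouring the closed neighbourhood of a low vertex *)

Section TwinClique.
Variables (G : sgraph) (k : nat).
Hypothesis k_ge6 : 6 <= k.
Local Notation low := (degset G k.-1).
Hypothesis deg_le : forall v : G, #|nbrs v| <= k.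
Hypothesis high_indep : forall x y : G, adj x y -> (x \in low) || (y \in low).
Hypothesis ncol : ~~ colS k.-1 [set: G].
Hypothesis crit_col : forall v : G, colS k.-1 [set~ v].

(* This is where k >= 6 is needed: disjoint lists would use at least
   h (k - 1 - h) >= 2 (k - 3) > k - 1 colours, where h = #|H|. *)
Lemma lists_meet (H : {set G}) (Av : G -> {set 'I_k.-1}) :
    1 < #|H| -> #|H| + 3 <= k -> (forall a, a \in H -> k.-1 - #|H| <= #|Av a|) ->
  exists a b c, [/\ a \in H, b \in H, a != b, c \in Av a & c \in Av b].
Proof.
move=> H2 Hk big.
have [/existsP[c]|none] := boolP [exists c, 1 < #|[set a in H | c \in Av a]|].
  case/card_gt1P=> a [b [+ + ab]]; rewrite !inE => /andP[aH ca] /andP[bH cb].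
  by exists a, b, c.
have le1 c : #|[set a in H | c \in Av a]| <= 1.
  by rewrite leqNgt; apply: contra none => ?; apply/existsP; exists c.
have ub : \sum_(a in H) #|Av a| <= k.-1.
  have -> : \sum_(a in H) #|Av a| = \sum_c #|[set a in H | c \in Av a]|.
    transitivity (\sum_(a in H) \sum_c (c \in Av a : nat)).
      by apply: eq_bigr => a _; rewrite -sum1_card big_mkcond.
    rewrite exchange_big /=; apply: eq_bigr => c _.
    rewrite -sum1_card big_mkcond [RHS]big_mkcond /=; apply: eq_bigr => a _.
    by rewrite inE; case: (a \in H).
  by rewrite -[X in _ <= X]card_ord -sum1_card; apply: leq_sum.
have lb : #|H| * (k.-1 - #|H|) <= \sum_(a in H) #|Av a|.
  by rewrite -sum_nat_const; apply: leq_sum.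
have {big le1 none} := leq_trans lb ub.
(* With [h = i + 2] and [k = h + 3 + j] the bounds give (i+2)(j+2) <= i+j+4, so i = j = 0 and k =
   5. *)
move: (#|H|) H2 Hk => h H2 Hk; have [j kE] : exists j, k = h + 3 + j.
  by exists (k - (h + 3)); lia.
have [i hE] : exists i, h = i + 2 by exists (h - 2); lia.
have -> : k.-1 - h = j + 2 by lia.
rewrite hE mulnDl !mulnDr => ?; move: k_ge6; nia.
Qed.

Lemma twin_clique x z u :
    [/\ x \in low, z \in low & u \in low] -> [/\ adj x z, adj x u & adj z u] ->
    (forall y, y \in low -> adj x y -> twins x y) ->
  forall v w : G, v != w -> adj v w.
Proof.
move=> [xlow zlow ulow] [xz xu zu] tw.
pose W := x |: nbrs x; pose L := W :&: low; pose H := W :\: low.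
have cW : #|W| = k.
  rewrite cardsU1 !inE adj_irrefl /=; move: xlow; rewrite inE => /eqP ->.
  by move: k_ge6; case: (k).
have LW y v : y \in L -> v != y -> adj y v = (v \in W).
  case/setIP; rewrite in_setU1 => yW ylow vy.
  have [yx|yx] := eqVneq y x; first by rewrite !inE -yx (negbTE vy).
  have xy : adj x y by move: yW; rewrite (negbTE yx) inE.
  have [->|vx] := eqVneq v x; first by rewrite adj_sym xy in_setU1 eqxx.
  by rewrite in_setU1 (negbTE vx) inE adj_sym (adj_sym x) (tw y ylow xy).
have cLH : #|L| + #|H| = k by rewrite cardsID.
have HL a : (a \in W) = (a \in L) || (a \in H).
  by rewrite in_setI in_setD; case: (a \in W); case: (a \in low).
have H_indep a b : a \in H -> b \in H -> adj a b = false.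
  move=> /setDP[_ al] /setDP[_ bl]; apply/negP => /high_indep.
  by rewrite (negbTE al) (negbTE bl).
have L3 : 2 < #|L|.
  have sub : x |: [set z; u] \subset L.
    by apply/subsetP=> v; rewrite in_setU1 in_set2 => /or3P[] /eqP->;
       rewrite in_setI in_setU1 inE ?xz ?xu ?eqxx ?orbT.
  apply: leq_trans (subset_leq_card sub); rewrite cardsU1 cards2 !inE.
  by rewrite (adj_neq zu) (negbTE (adj_neq xz)) (negbTE (adj_neq xu)).
have [H1|H2] := leqP #|H| 1.
  have cliqueW v w : v \in W -> w \in W -> v != w -> adj v w.
    move=> vW wW vw; move: (vW) (wW); rewrite !HL.
    case/orP=> [vL _|vH]; first by rewrite LW // eq_sym.
    case/orP=> [wL|wH]; first by rewrite adj_sym LW.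
    by move: vw; rewrite (card_le1_eqP H1 v w vH wH) eqxx.
  suff WT v : v \in W by move=> v w; apply: cliqueW.
  apply: contraT => vW.
  (* A vertex outside [W] would make the k-clique [W] colourable with k - 1 colours. *)
  have /colSP[f Hf] : colS k.-1 W.
    by apply: colS_sub (crit_col v); apply/subsetP=> w wW; rewrite !inE;
       apply: contraNneq vW => <-.
  have injf : {in W &, injective f}.
    move=> a b aW bW fab; apply/eqP; apply: contraT => ab.
    by have := Hf a b aW bW (cliqueW a b aW bW ab); rewrite fab eqxx.
  have := max_card (f @: W); rewrite card_in_imset // card_ord cW.
  by move: k_ge6; case: (k) => // j _; rewrite ltnn.
have /colSP[f Hf] := crit_col x.
pose Av a : {set 'I_k.-1} := ~: (f @: (nbrs a :\: W)).
(* A high vertex has degree at most k and sees all k - |H| vertices of [L]. *)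
have out_le a : a \in H -> #|nbrs a :\: W| <= #|H|.
  move=> aH; have Ln : L \subset nbrs a :&: W.
    apply/subsetP=> y yL; have aW : a \in W by rewrite HL aH orbT.
    have ay : a != y.
      by apply: contraTneq aH => ->; move: yL; rewrite in_setD !in_setI => /andP[_ ->].
    by rewrite in_setI (HL y) yL andbT inE adj_sym LW.
  have := subset_leq_card Ln; have := cardsID W (nbrs a); have := deg_le a.
  by move: cLH; clear; lia.
have Av_ge a : a \in H -> k.-1 - #|H| <= #|Av a|.
  move=> aH; have := cardsC (f @: (nbrs a :\: W)); rewrite card_ord => Ccard.
  rewrite leq_subLR -[X in X <= _]Ccard leq_add2r.
  exact: leq_trans (leq_imset_card f _) (out_le a aH).
have H3 : #|H| + 3 <= k by rewrite -cLH addnC leq_add2r.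
have [a [b [c [aH bH ab ca cb]]]] := lists_meet H2 H3 Av_ge.
(* On [H] the default [c] is never reached, as every list has at least k - 1 - |H| >= 2 colours. *)
pose g v := if (v == a) || (v == b) then c else odflt c [pick d in Av v].
have gP v : v \in H -> g v \in Av v.
  rewrite /g => vH; have [->|_] := eqVneq v a; first by rewrite ca.
  have [->|_] := eqVneq v b; first by rewrite cb.
  case: pickP => //= none; have := Av_ge v vH.
  by rewrite (eq_card0 none); move: H3 k_ge6; clear; lia.
have gH : #|g @: H| < #|H|.
  have -> : g @: H = g @: (H :\ b).
    apply/setP=> d; apply/imsetP/imsetP => -[v vH ->].
      have [->|vb] := eqVneq v b.
        by exists a; rewrite ?in_setD1 ?ab // /g !eqxx orbT.
      by exists v; rewrite // in_setD1 vb.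
    by exists v => //; case/setD1P: vH.
  apply: leq_ltn_trans (leq_imset_card _ _) _.
  by rewrite [X in _ < X](cardsD1 b) bH.
(* The repeated colour leaves at least (k - 1) - (|H| - 1) = |L| colours, so [L] can be coloured
   injectively; its vertices have no neighbours outside [W]. *)
have cardL : #|L| <= #|~: (g @: H)|.
  have := cardsC (g @: H); rewrite card_ord.
  by move: gH cLH; clear; lia.
have [l [lP linj]] := card_inj_le cardL (ltnW (ltnW L3)).
case/negP: ncol; apply/colSP.
pose hcol v := if v \in L then l v else if v \in H then g v else f v.
have hL v : v \in L -> hcol v = l v by rewrite /hcol => ->.
have hH v : v \in H -> hcol v = g v.
  rewrite /hcol; case: ifP => [|_ ->//].
  by rewrite in_setI in_setD => /andP[_ ->].
have hO v : v \notin W -> hcol v = f v.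
  by rewrite HL negb_or /hcol => /andP[/negbTE-> /negbTE->].
have LO v w : v \in L -> adj v w -> w \in W.
  by move=> vL vw; rewrite -(LW v w vL) // eq_sym adj_neq.
have LHne v w : v \in L -> w \in H -> hcol v != hcol w.
  move=> vL wH; rewrite hL // hH //; have := lP v vL; rewrite inE.
  by apply: contraNneq => ->; apply: imset_f.
have HOne v w : v \in H -> w \notin W -> adj v w -> hcol v != hcol w.
  move=> vH wO vw; rewrite (hO w) // (hH v) //; have := gP v vH; rewrite inE.
  by apply: contraNneq => ->; apply: imset_f; rewrite in_setD wO inE.
exists hcol => v w _ _ vw; have wv : adj w v by rewrite adj_sym.
have [vW|vO] := boolP (v \in W); have [wW|wO] := boolP (w \in W).
- move: (vW) (wW); rewrite !HL => /orP[vL|vH] /orP[wL|wH].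
  + rewrite !hL //; apply: contraTneq vw => /(linj v w vL wL) ->.
    by rewrite adj_irrefl.
  + exact: LHne.
  + by rewrite eq_sym; apply: LHne.
  + by rewrite H_indep in vw.
- have vH : v \in H.
    move: vW; rewrite HL => /orP[vL|//]; by rewrite (LO v w) in wO.
  exact: HOne.
- have wH : w \in H.
    move: wW; rewrite HL => /orP[wL|//]; by rewrite (LO w v) in vO.
  by rewrite eq_sym; apply: HOne.
have nx y : y \notin W -> y \in [set~ x].
  by move=> yO; rewrite !inE; apply: contraNneq yO => ->; rewrite setU11.
by rewrite !hO //; apply: Hf; rewrite ?nx.
Qed.

End TwinClique.

(** * Chromatic number and assembly of the proof *)

Lemma chi_col (G : sgraph) : colorable G (chi G).
Proof. by rewrite /chi; case: ex_minnP. Qed.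

Lemma chi_min (G : sgraph) n : colorable G n -> chi G <= n.
Proof. by rewrite /chi; case: ex_minnP => m _; apply. Qed.

Lemma colorableP (G : sgraph) n : reflect
  (exists f : G -> 'I_n, forall x y, adj x y -> f x != f y) (colorable G n).
Proof.
apply: (iffP existsP) => -[f Hf].
  by exists f => x y; move/forallP/(_ x)/forallP/(_ y)/implyP: Hf.
exists (finfun f); apply/forallP=> x; apply/forallP=> y; apply/implyP=> xy.
by rewrite !ffunE; apply: Hf.
Qed.

Lemma colS_colorable (G : sgraph) n : colS n [set: G] = colorable G n.
Proof.
apply/colSP/colorableP => -[f Hf]; exists f => x y.
  by apply: Hf; rewrite in_setT.
by move=> _ _; apply: Hf.
Qed.

Lemma colorable_mono (G : sgraph) m n : m <= n -> colorable G m -> colorable G n.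
Proof.
move=> mn /colorableP[f Hf]; apply/colorableP.
exists (fun v => widen_ord mn (f v)) => x y xy.
by have := Hf x y xy; apply: contraNneq => /(congr1 val) /= /ord_inj ->.
Qed.

Lemma critical_col (G : sgraph) (v : G) : critical G -> 1 < chi G ->
  colS (chi G).-1 [set~ v].
Proof.
move=> /(_ v) lt chi_gt1; have chi_gt0 : 0 < (chi G).-1 by case: (chi G) chi_gt1.
have : chi (delete_vertex v) <= (chi G).-1 by case: (chi G) lt.
move/colorable_mono/(_ (chi_col _))/colorableP => [f Hf]; apply/colSP.
(* Only [v] itself, outside the coloured set, gets the default colour. *)
exists (fun y => if insub y is Some y' then f y' else Ordinal chi_gt0) => x y xv yv xy.
by rewrite !insubT; apply: Hf.
Qed.

Lemma complete_iso (G : sgraph) : (forall v w : G, v != w -> adj v w) ->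
  isomorphic G (complete (chi G)).
Proof.
move=> adjG; have /colorableP[f Hf] := chi_col G.
have injf : injective f.
  move=> v w /eqP fvw; apply/eqP; apply: contraLR fvw => vw.
  exact/Hf/adjG.
have cardG : chi G <= #|G|.
  apply/chi_min/colorableP; exists enum_rank => v w vw.
  by rewrite (inj_eq enum_rank_inj) adj_neq.
exists f; first by apply: inj_card_bij; rewrite ?card_ord.
move=> v w; rewrite /adj /= /complete_adj (inj_eq injf).
by apply/idP/idP => [/adjG|/adj_neq].
Qed.

Theorem corollaryN (G : sgraph) (Gcrit : critical G)
    (chi_ge : Delta G <= chi G) (Delta_ge : 6 <= Delta G)
    (Hindep : edgeless (high_subgraph G)) :
  isomorphic G (complete (chi G)).
Proof.
have chi6 := leq_trans Delta_ge chi_ge.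
have predchi : (chi G).-1.+1 = chi G by apply/prednK/(leq_trans _ chi6).
have crit_colG v := @critical_col G v Gcrit (leq_trans (isT : 1 < 6) chi6).
have deg_le (v : G) : #|nbrs v| <= (chi G).-1.+1.
  rewrite predchi; apply: leq_trans chi_ge.
  exact: (leq_bigmax (F := @deg G) v).
have ncol : ~~ colS (chi G).-1 [set: G].
  by rewrite colS_colorable; apply/negP => /chi_min; move: chi6; case: chi => // n _; rewrite ltnn.
(* At a vertex of smaller degree a colouring of the rest would extend greedily. *)
have deg_ge (v : G) : (chi G).-1 <= #|nbrs v|.
  rewrite leqNgt; apply: contra ncol => small.
  have -> : [set: G] = v |: [set~ v] by apply/setP=> w; rewrite !inE orbN.
  by apply: colS_add => //; apply: leq_ltn_trans small; apply/subset_leq_card/subsetIl.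
have high_indep (x y : G) : adj x y ->
    (x \in degset G (chi G).-1) || (y \in degset G (chi G).-1).
  have high v : v \notin degset G (chi G).-1 -> v \in [set v : G | chi G <= deg v].
    by move=> vl; have := deg_ge v; rewrite leq_eqVlt eq_sym; move: vl;
       rewrite !inE => /negbTE -> /=; rewrite predchi.
  apply: contraTT; rewrite negb_or => /andP[/high xh /high yh].
  exact: (Hindep (exist _ x xh) (exist _ y yh)).
apply: complete_iso => v w vw.
(* Completeness is put in boolean form to serve as [Q]. *)
suff /forallP/(_ v)/forallP/(_ w)/implyP/(_ vw) :
  [forall v : G, forall w : G, (v != w) ==> adj v w] by [].
apply: (low_clique_twins (R := (chi G).-1)) => //.
  by move: chi6; case: chi => // n; rewrite ltnS => /ltnW.
move=> x z u lows adjs tw; apply/forallP=> a; apply/forallP=> b; apply/implyP.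
apply: (twin_clique chi6 _ high_indep ncol crit_colG lows adjs tw).
by move=> y; have := deg_le y; rewrite predchi.
Qed.
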